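(* Let $d\ge1$, $I=[0,1)^d$, and let $S\subset\mathbb{R}^d$ be a non-empty set such that the cubes $I+s$, $s\in S$, are pairwise disjoint. Let $u\in\mathbb{R}^d$ with $u\notin S$. If $I+u\subseteq\bigcup_{s\in S}(I+s)$, then there are $t,t'\in S$ such that $t-t'\in\{-1,0,1\}^d$ and the number $|\{i\in[d]\colon |t_i-t'_i|=1\}|$ is odd.
   Context: $[d]=\{1,\dots,d\}$. *)

(* Defs.v *)
From mathcomp Require Import all_boot all_order all_algebra.
From mathcomp Require Import all_classical all_reals.

Set Implicit Arguments.
Unset Strict Implicit.
Unset Printing Implicit Defensive.

Import Order.TTheory GRing.Theory Num.Theory.

Local Open Scope classical_set_scope.
Local Open Scope ring_scope.

(* Points of R^d are row vectors; coordinates are indexed by 'I_d. *)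

Definition unit_cube (R : realType) (d : nat) : set 'rV[R]_d :=
  [set x | forall i, 0 <= x ord0 i < 1].

Definition translate (R : realType) (d : nat) (A : set 'rV[R]_d)
    (s : 'rV[R]_d) : set 'rV[R]_d :=
  [set x + s | x in A].

(* Main.v *)
(* Call s in S relevant if I + s meets I + u, and put
   phi_i(s) = frac (u_i - s_i).  There are finitely many relevant s; let m be
   one maximizing sum_i phi_i, and let C be the set of i with phi_i(m) <> 0,
   which is non-empty because u is not in S.  For A included in C let p_A be the
   point of I + u with coordinates u_i + 1 - phi_i(m) for i in A and u_i
   otherwise; it lies in a unique cube I + s.  If phi(s) <> phi(m) then, by
   maximality, phi_i(s) < phi_i(m) for some i in C, and I + s also contains the
   point obtained by toggling i in A.  This is a sign-reversing involution, so
   the sum of (-1)^|A| over the A whose cube satisfies phi(s) = phi(m) vanishes.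
   Such A exist (the cube of A = {i | u_i < m_i} is I + m), so two of them, A and
   A', have opposite parities, and the i-th coordinates of their cubes differ by
   [i in A] - [i in A']. *)

Require Import Defs.
From mathcomp Require Import all_boot all_order all_algebra.
From mathcomp Require Import all_classical all_reals.
From mathcomp Require Import lra.

Set Implicit Arguments.
Unset Strict Implicit.
Unset Printing Implicit Defensive.

Import Order.TTheory GRing.Theory Num.Theory.

Local Open Scope classical_set_scope.
Local Open Scope ring_scope.

Section SymmetricDifference.
Variable T : finType.
Implicit Types A B : {set T}.

Definition symdiff A B : {set T} := [set i | (i \in A) (+) (i \in B)]%SET.

Lemma in_symdiff A B i : (i \in symdiff A B) = (i \in A) (+) (i \in B).
Proof. by rewrite inE. Qed.

Lemma symdiffK A B : symdiff (symdiff A B) B = A.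
Proof. by apply/setP => i; rewrite !in_symdiff addbK. Qed.

Lemma odd_card_symdiff A B : odd #|symdiff A B| = odd #|A| (+) odd #|B|.
Proof.
have -> : symdiff A B = ((A :\: B) :|: (B :\: A))%SET.
  by apply/setP => i; rewrite in_symdiff !inE; case: (i \in A); case: (i \in B).
have dAB : ((A :\: B) :&: (B :\: A) = finset.set0)%SET.
  by apply/setP => i; rewrite !inE; case: (i \in A); rewrite ?andbF.
rewrite -(cardsID B A) -(cardsID A B) (finset.setIC B A) cardsU.
rewrite dAB cards0 subn0 !oddD.
by rewrite addbACA addbb.
Qed.

End SymmetricDifference.

(** Reindexing along the involution [f] turns the sum into its own opposite, which forces 0 in a
    [numDomainType]. *)
Lemma sum_sign_reversing (T : finType) (V : numDomainType) (P : pred T)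
    (f : T -> T) (w : T -> V) :
  (forall x, P x -> [/\ P (f x), f (f x) = x & w (f x) = - w x]) ->
  \sum_(x | P x) w x = 0.
Proof.
move=> Pf; apply/eqP; rewrite -eqNr -sumrN; apply/eqP.
rewrite [RHS](reindex_onto f f) /=; last by move=> x /Pf[].
apply: eq_big => [x|x /Pf[_ _ ->]//].
apply/idP/andP => [/Pf[-> -> _]//|[/Pf[Px _ _] /eqP ffx]].
by rewrite -ffx.
Qed.

Section Cubes.
Variables (R : realType) (d : nat).
Implicit Types (x s t u : 'rV[R]_d) (S : set 'rV[R]_d).

Lemma translate_cubeP s x :
  translate (@unit_cube R d) s x <->
  forall i, s ord0 i <= x ord0 i < s ord0 i + 1.
Proof.
split=> [[y yI <-] i|sx].
  by rewrite !mxE; have := yI i; lra.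
exists (x - s); last by rewrite subrK.
by move=> i; rewrite !mxE; have := sx i; lra.
Qed.

Lemma disjoint_cubes_inj S s t x :
  trivIset S (fun s => translate (@unit_cube R d) s) -> S s -> S t ->
  (forall i, s ord0 i <= x ord0 i < s ord0 i + 1) ->
  (forall i, t ord0 i <= x ord0 i < t ord0 i + 1) -> s = t.
Proof.
move=> hS Ss St sx tx; apply: (hS s t Ss St).
by exists x; split; apply/translate_cubeP.
Qed.

(** Coordinatewise form of the condition that the half-open cubes [I + s] and [I + u] intersect. *)
Definition meets u s := forall i, u ord0 i - 1 < s ord0 i < u ord0 i + 1.

(* The fractional part of [u_i - s_i] when [meets u s]. *)
Definition frac u s i : R := u ord0 i - s ord0 i + (u ord0 i < s ord0 i)%R%:R.

Lemma frac_bounds u s i : meets u s -> 0 <= frac u s i < 1.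
Proof.
by move=> /(_ i); rewrite /frac; case: (ltP (u ord0 i) (s ord0 i)) => /=; lra.
Qed.

Lemma meets_common u s x :
  (forall i, u ord0 i <= x ord0 i < u ord0 i + 1) ->
  (forall i, s ord0 i <= x ord0 i < s ord0 i + 1) -> meets u s.
Proof. by move=> ux sx i; have := ux i; have := sx i; lra. Qed.

(* A cube meeting [I + u] contains the vertex [u + 1_A] of the closure of
   [I + u], where [A] is the set of [i] with [u_i < s_i]; so there are at most
   [2 ^ d] such cubes. *)
Lemma max_meets S u (F : 'rV[R]_d -> R) s0 :
  trivIset S (fun s => translate (@unit_cube R d) s) ->
  S s0 -> meets u s0 ->
  exists m, [/\ S m, meets u m & forall s, S s -> meets u s -> F s <= F m].
Proof.
move=> hS Ss0 us0.
pose right s : {set 'I_d} := [set i | (u ord0 i < s ord0 i)%R]%SET.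
have right_inj s t : S s -> S t -> meets u s -> meets u t ->
    right s = right t -> s = t.
  move=> Ss St us ut /setP rst.
  apply: (@disjoint_cubes_inj S s t
    (\row_i (u ord0 i + (u ord0 i < s ord0 i)%R%:R))) => // i.
    by have := us i; rewrite mxE; case: (ltP (u ord0 i) (s ord0 i)) => /=; lra.
  have := rst i; rewrite !inE mxE => ->.
  by have := ut i; case: (ltP (u ord0 i) (t ord0 i)) => /=; lra.
(* Subsets of ['I_d] index the relevant cubes, with [s0] standing in where no cube has [right] set
   [A]; the maximum is then over a finite type. *)
have /choice[g gP] : forall A, exists t, [/\ S t, meets u t &
    forall s, S s -> meets u s -> right s = A -> s = t].
  move=> A; have [[t [St ut rt]]|noA] :=
    pselect (exists t, [/\ S t, meets u t & right t = A]).
    by exists t; split=> // s Ss us rs; apply: right_inj; rewrite // rs.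
  by exists s0; split=> // s Ss us rs; case: noA; exists s.
case: (@arg_maxP _ _ _ (right s0) xpredT (F \o g)) => // A _ maxA.
exists (g A); case: (gP A) => SA uA _; split=> // s Ss us.
have [_ _ /(_ s Ss us erefl) ->] := gP (right s).
exact: maxA.
Qed.

End Cubes.

Theorem theorem2 (R : realType) (d : nat) (hd : (1 <= d)%N)
    (S : set 'rV[R]_d) (hS0 : S !=set0)
    (hS : trivIset S (fun s => translate (@unit_cube R d) s))
    (u : 'rV[R]_d) (hu : ~ S u)
    (hcover : translate (@unit_cube R d) u `<=`
       \bigcup_(s in S) translate (@unit_cube R d) s) :
  exists t t' : 'rV[R]_d,
    [/\ S t, S t',
        (forall i : 'I_d, (t - t') ord0 i \in [:: -1; 0; 1]) &
        odd #|[set i : 'I_d | `|t ord0 i - t' ord0 i| == 1]%SET| ].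
Proof.
have ex_cube (x : 'rV[R]_d) : (forall i, u ord0 i <= x ord0 i < u ord0 i + 1) ->
    exists2 s, S s & forall i, s ord0 i <= x ord0 i < s ord0 i + 1.
  move=> ux; have [|s Ss /translate_cubeP sx] := hcover x.
    exact/translate_cubeP.
  by exists s.
have [s0 Ss0 s0u] : exists2 s, S s & forall i, s ord0 i <= u ord0 i < s ord0 i + 1.
  by apply: ex_cube => i; lra.
have us0 : meets u s0 by apply: meets_common s0u => i; lra.
have [m [Sm um maxm]] := max_meets (fun s => \sum_i frac u s i) hS Ss0 us0.
have frac_max s : S s -> meets u s -> (forall i, frac u m i <= frac u s i) ->
    forall i, frac u s i = frac u m i.
  move=> Ss us ge_m i; apply/eqP; rewrite eq_le ge_m andbT leNgt.
  apply/negP => lt_i; have := maxm s Ss us; rewrite leNgt => /negP; apply.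
  by rewrite (bigD1 i) //= [ltRHS](bigD1 i) //= ltr_leD // ler_sum.
pose C := [set i : 'I_d | frac u m i != 0]%SET.
have [i0 i0C] : exists i : 'I_d, i \in C.
  (* If all [frac u m i] were 0, maximality would make those of [s0] vanish too, and [u] would equal
     [s0]. *)
  apply: contrapT => C0; apply: hu.
  have m0 i : frac u m i = 0.
    by apply/eqP/negPn/negP => mi; apply: C0; exists i; rewrite inE.
  suff -> : u = s0 by [].
  apply/rowP => i.
  have frac0 : frac u s0 i = 0.
    rewrite frac_max // => j.
    by rewrite m0; have /andP[] := frac_bounds j us0.
  move: frac0; rewrite /frac.
  by have := s0u i; case: (ltP (u ord0 i) (s0 ord0 i)) => /=; lra.
pose p (A : {set 'I_d}) : 'rV[R]_d :=
  \row_i (u ord0 i + (if i \in A then 1 - frac u m i else 0)).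
have pE (A : {set 'I_d}) i : p A ord0 i =
    u ord0 i + (if i \in A then 1 - frac u m i else 0) by rewrite mxE.
have p_in (A : {set 'I_d}) i : A \subset C -> u ord0 i <= p A ord0 i < u ord0 i + 1.
  move=> /fintype.subsetP sAC; rewrite pE; have := frac_bounds i um.
  case: ifPn => [/sAC|_]; last lra.
  rewrite inE => mi /andP[m0 m1].
  have : 0 < frac u m i by rewrite lt_def mi.
  by lra.
have /choice[c c_spec] : forall A : {set 'I_d}, exists s, A \subset C ->
    S s /\ forall i, s ord0 i <= p A ord0 i < s ord0 i + 1.
  move=> A; have [sAC|nAC] := boolP (A \subset C); last by exists u.
  by have [|s Ss sp] := ex_cube (p A); [move=> i; exact: p_in|exists s].
have c_in (A : {set 'I_d}) : A \subset C -> S (c A) by move=> /c_spec[].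
have c_cover (A : {set 'I_d}) i :
    A \subset C -> c A ord0 i <= p A ord0 i < c A ord0 i + 1.
  by move=> /c_spec[_].
have c_meets (A : {set 'I_d}) : A \subset C -> meets u (c A).
  by move=> sAC; apply: (@meets_common _ _ _ _ (p A)) => i;
    [exact: p_in|exact: c_cover].
have c_uniq (A : {set 'I_d}) s : A \subset C -> S s ->
    (forall i, s ord0 i <= p A ord0 i < s ord0 i + 1) -> c A = s.
  move=> sAC Ss sp; apply: (disjoint_cubes_inj hS (c_in A sAC) Ss _ sp) => i.
  exact: c_cover.
pose good (A : {set 'I_d}) := [forall i, frac u (c A) i == frac u m i].
(* Goodness fixes the coordinate modulo 1, and covering [p A] leaves a single value. *)
have goodP (A : {set 'I_d}) i : A \subset C -> good A ->
    c A ord0 i = u ord0 i - frac u m i + (i \in A)%:R.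
  move=> sAC /forallP/(_ i)/eqP cAi.
  have := c_cover A i sAC; rewrite pE -cAi /frac.
  have := c_meets A sAC i.
  by case: (i \in A); case: (ltP (u ord0 i) (c A ord0 i)) => /=; lra.
have [A0 A0C A0good] : exists2 A : {set 'I_d}, A \subset C & good A.
  pose A := [set i | (u ord0 i < m ord0 i)%R]%SET.
  have sAC : A \subset C.
    apply/fintype.subsetP => i; rewrite !inE /frac => um_i; rewrite um_i /=.
    by have := um i; rewrite neq_lt; lra.
  (* Where [u_j < m_j] the coordinate of [p A] is exactly [m_j]; elsewhere it is [u_j], between
     [m_j] and [m_j + 1]. *)
  exists A => //; apply/forallP => i; rewrite (c_uniq A m) // => j.
  rewrite pE inE /frac; have := um j.
  by case: (ltP (u ord0 j) (m ord0 j)) => /=; lra.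
(* The picked index depends on [A] only through [c A]; since toggling it preserves the cube ([cE]),
   the same index is picked again and [toggle] is an involution on bad sets. *)
pose toggle (A : {set 'I_d}) :=
  oapp (fun i => symdiff A [set i]%SET) A [pick i | frac u (c A) i < frac u m i].
have sgnE (A : {set 'I_d}) i :
    (-1) ^+ odd #|symdiff A [set i]%SET| = - (-1) ^+ odd #|A| :> int.
  by rewrite odd_card_symdiff cards1 addbT; case: odd.
have symdiff_sub (A : {set 'I_d}) i :
    i \in C -> A \subset C -> symdiff A [set i]%SET \subset C.
  move=> iC /fintype.subsetP sAC; apply/fintype.subsetP => j.
  rewrite in_symdiff inE; have [-> //|_] := eqVneq j i.
  by rewrite addbF => /sAC.
have bad_sum :
    \sum_(A : {set 'I_d} | (A \subset C) && ~~ good A) (-1) ^+ odd #|A| = 0 :> int.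
  apply: (sum_sign_reversing (f := toggle)) => A /andP[sAC nA].
  have [i lt_i toggleE] : exists2 i, frac u (c A) i < frac u m i &
      forall B, c B = c A -> toggle B = symdiff B [set i]%SET.
    case Ei : [pick i | frac u (c A) i < frac u m i] => [i|].
      exists i => [|B cB]; last by rewrite /toggle cB Ei.
      by move: Ei; case: pickP => // j ? [<-].
    case/negP: nA; apply/forallP => i; apply/eqP.
    apply: frac_max; [exact: c_in|exact: c_meets|move=> j].
    by move: Ei; case: pickP => // /(_ j) /negbT; rewrite -leNgt.
  have iC : i \in C.
    rewrite inE; apply: contraTneq lt_i => ->.
    by rewrite -leNgt; have /andP[] := frac_bounds i (c_meets A sAC).
  have tC := symdiff_sub A i iC sAC.
  (* Write [s] for [c A]. Either position of [p A] in coordinate [i] yields [s_i <= u_i], so [lt_i]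
     reads [u_i - s_i < frac u m i]: both [u_i] and [u_i + 1 - frac u m i] lie in
     [[s_i, s_i + 1)]. *)
  have cE : c (symdiff A [set i]%SET) = c A.
    apply: c_uniq => // [|j]; first exact: c_in.
    have := c_cover A j sAC; rewrite !pE in_symdiff inE.
    have [->|_] := eqVneq j i; last by rewrite addbF.
    rewrite addbT; move: lt_i (frac_bounds i um).
    have := c_meets A sAC i; rewrite /frac.
    by case: (i \in A) => /=; case: (ltP (u ord0 i) (c A ord0 i)) => /=; lra.
  rewrite toggleE //; split; last exact: sgnE.
    by rewrite tC /= /good cE.
  by rewrite toggleE // symdiffK.
(* Toggling the fixed element [i0] of [C] pairs off all subsets of [C]. *)
have all_sum :
    \sum_(A : {set 'I_d} | A \subset C) (-1) ^+ odd #|A| = 0 :> int.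
  apply: (sum_sign_reversing (f := fun A => symdiff A [set i0]%SET)) => A sAC.
  by split; [exact: symdiff_sub|exact: symdiffK|exact: sgnE].
have [B [BC Bgood parity]] : exists B : {set 'I_d},
    [/\ B \subset C, good B & odd #|B| != odd #|A0|].
  apply: contrapT => noB.
  have eq_odd (B : {set 'I_d}) : (B \subset C) && good B -> odd #|B| = odd #|A0|.
    move=> /andP[BC Bg]; apply/eqP/negPn/negP => ?; apply: noB; exists B.
    by split.
  (* With equal parities the good terms would add up to a sign times their number, which is nonzero
     because [A0] is counted. *)
  move: all_sum; rewrite (bigID good) /= bad_sum addr0.
  under eq_bigr => B /eq_odd-> do over.
  rewrite sumr_const => /eqP; rewrite mulrn_eq0 signr_eq0 orbF => /eqP/card0_eq.
  by move=> /(_ A0); rewrite unfold_in /= A0C A0good.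
have diffE i : c A0 ord0 i - c B ord0 i = (i \in A0)%:R - (i \in B)%:R.
  by rewrite !goodP //; lra.
exists (c A0), (c B); split; [exact: c_in|exact: c_in| |].
  move=> i; rewrite !mxE diffE !inE.
  by case: (i \in A0); case: (i \in B); rewrite /= ?subrr ?subr0 ?sub0r ?eqxx ?orbT.
have -> : [set i | `|c A0 ord0 i - c B ord0 i| == 1]%SET = symdiff A0 B.
  apply/setP => i; rewrite in_symdiff inE diffE.
  case: (i \in A0); case: (i \in B);
  by rewrite /= ?subrr ?subr0 ?sub0r ?normrN
     ?normr1 ?normr0 ?eqxx // eq_sym oner_eq0.
by rewrite odd_card_symdiff; move: parity; do 2 case: odd.
Qed.
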